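(* Let $|\psi_1\rangle$ and $|\psi_2\rangle$ be two entangled bipartite pure states. Then $$D^c(|\psi_1\rangle,|\psi_2\rangle)=D(|\psi_1\rangle,|\psi_2\rangle),$$ where $D$ is the deterministic entanglement exchange rate and $D^c$ is the entanglement-assisted (catalyst-assisted) deterministic entanglement exchange rate.
   Context: All states are bipartite pure states on finite-dimensional spaces. Such a state has a Schmidt decomposition $|\psi\rangle=\sum_{i=1}^n\sqrt{\alpha_i}\,|i\rangle|i\rangle$ with $\alpha_1\ge\dots\ge\alpha_n\ge 0$, $\sum_i\alpha_i=1$; the numbers $\alpha_i$ (without square root) are called its Schmidt coefficients, and $\lambda_\psi=(\alpha_1,\dots,\alpha_n)$ is its ordered Schmidt coefficient vector. The state is entangled if at least two Schmidt coefficients are nonzero (equivalently $\alpha_1<1$). For a tensor product of bipartite states, each party holds the corresponding halves of all factors, so the Schmidt coefficients of $|\psi\rangle\otimes|\phi\rangle$ are all products of a Schmidt coefficient of $|\psi\rangle$ with one of $|\phi\rangle$. Write $|\psi_1\rangle\rightarrow|\psi_2\rangle$ if $|\psi_1\rangle$ can be transformed into $|\psi_2\rangle$ with certainty by local operations and classical communication (LOCC). By Nielsen's theorem (known, may be used as the definition), this holds if and only if $\lambda_{\psi_1}\prec\lambda_{\psi_2}$, i.e. for every $l$ the sum of the $l$ largest components of $\lambda_{\psi_1}$ is at most that of $\lambda_{\psi_2}$ (vectors being padded with zeros to a common length). For entangled states $|\psi_1\rangle,|\psi_2\rangle$ and a positive integer $m$, let $f(m)=\max\{n\geq 1: |\psi_1\rangle^{\otimes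 m}\rightarrow|\psi_2\rangle^{\otimes n}\}$, with $f(m)=0$ if this set is empty. The deterministic entanglement exchange rate is $D(|\psi_1\rangle,|\psi_2\rangle)=\sup_{m\ge1}\frac{f(m)}{m}$. Likewise let $f'(m)=\max\{n\ge1:\ \text{there is a bipartite pure state } |\phi\rangle \text{ with } |\psi_1\rangle^{\otimes m}\otimes|\phi\rangle\rightarrow|\psi_2\rangle^{\otimes n}\otimes|\phi\rangle\}$, with $f'(m)=0$ if this set is empty, and $D^c(|\psi_1\rangle,|\psi_2\rangle)=\sup_{m\ge1}\frac{f'(m)}{m}$. *)

(* Defs.v *)
From HB Require Import structures.
From mathcomp Require Import all_boot all_order all_algebra.
From mathcomp Require Import complex mxtens.
From mathcomp Require Import boolp classical_sets reals ereal.

Set Implicit Arguments.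
Unset Strict Implicit.
Unset Printing Implicit Defensive.

Import Order.TTheory GRing.Theory Num.Theory.

Local Open Scope classical_set_scope.
Local Open Scope ring_scope.

(* A vector of C^a (x) C^b is given by its coefficient matrix
   psi : 'M[R[i]]_(a, b), with psi i j the coefficient of |i>|j>.  For this
   encoding the tensor product of bipartite vectors in which each party holds
   its halves of all the factors is the Kronecker product *t, and the n-fold
   tensor power is ^t n. *)

Definition is_state (R : realType) (a b : nat) (psi : 'M[R[i]]_(a, b)) : Prop :=
  \sum_i \sum_j `|psi i j| ^+ 2 = 1.

(* psi = \sum_k sqrt(s_k) |e_k>|f_k>, where |e_k> and |f_k> are the k-th rows of
   U and V.  Membership in unitarymx, for a rectangular matrix, says that the
   rows are orthonormal.  For a given psi, s is unique up to trailing zeros. *)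
Definition schmidt_coefs (R : realType) (a b : nat) (psi : 'M[R[i]]_(a, b))
    (s : seq R) : Prop :=
  [/\ sorted >=%R s, all (>= 0) s &
    exists (U : 'M[R[i]]_(size s, a)) (V : 'M[R[i]]_(size s, b)),
      [/\ U \is unitarymx, V \is unitarymx &
        psi = \sum_(k < size s)
                (Num.sqrt s`_k)%:C%C *: ((row k U)^T *m row k V)]].

Definition entangled (R : realType) (a b : nat) (psi : 'M[R[i]]_(a, b)) : Prop :=
  exists2 s : seq R, schmidt_coefs psi s & (2 <= count (fun x : R => x != 0%R) s)%N.

(* Majorization of nonincreasing sequences: the first l entries are then the l
   largest ones.  Reading past the end yields 0, which is the zero padding. *)
Definition majorized (R : realType) (s t : seq R) : Prop :=
  forall l : nat, \sum_(k < l) s`_k <= \sum_(k < l) t`_k.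

(* Deterministic LOCC convertibility, through Nielsen's theorem. *)
Definition locc (R : realType) (a b c d : nat)
    (psi : 'M[R[i]]_(a, b)) (phi : 'M[R[i]]_(c, d)) : Prop :=
  exists s t : seq R,
    [/\ schmidt_coefs psi s, schmidt_coefs phi t & majorized s t].

(* The maximum of A, or 0 if A is empty.  The sets it is applied to below are
   bounded when psi2 is entangled: the Schmidt rank is multiplicative, does not
   increase under locc, and is at least 2 for psi2. *)
Definition max_or0 (A : set nat) : nat := xget 0%N (A `&` ubound A).

Definition max_copies (R : realType) (a b c d : nat)
    (psi1 : 'M[R[i]]_(a, b)) (psi2 : 'M[R[i]]_(c, d)) (m : nat) : nat :=
  max_or0 [set n | (1 <= n)%N /\ locc (psi1 ^t m) (psi2 ^t n)].

Definition exchange_rate (R : realType) (a b c d : nat)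
    (psi1 : 'M[R[i]]_(a, b)) (psi2 : 'M[R[i]]_(c, d)) : \bar R :=
  ereal_sup [set ((max_copies psi1 psi2 m)%:R / m%:R)%:E
            | m in [set m | (1 <= m)%N]].

Definition catalytic_max_copies (R : realType) (a b c d : nat)
    (psi1 : 'M[R[i]]_(a, b)) (psi2 : 'M[R[i]]_(c, d)) (m : nat) : nat :=
  max_or0 [set n | (1 <= n)%N /\
    exists (p q : nat) (phi : 'M[R[i]]_(p, q)),
      is_state phi /\ locc (psi1 ^t m *t phi) (psi2 ^t n *t phi)].

Definition catalytic_exchange_rate (R : realType) (a b c d : nat)
    (psi1 : 'M[R[i]]_(a, b)) (psi2 : 'M[R[i]]_(c, d)) : \bar R :=
  ereal_sup [set ((catalytic_max_copies psi1 psi2 m)%:R / m%:R)%:E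
            | m in [set m | (1 <= m)%N]].

(* Main.v *)
(* Write h_x(s) = sum_i max(s_i - x, 0).  For nonincreasing nonnegative vectors
   s is majorized by t iff h_x(s) <= h_x(t) for all x >= 0; the right-hand side
   does not depend on the order of the entries and is visibly preserved by
   tensoring, so a catalytic conversion psi1^m (x) phi -> psi2^n (x) phi can be
   iterated into psi1^(km) (x) phi -> psi2^(kn) (x) phi.  Since psi1 is
   entangled, the entries of psi1^p tend to 0, so phi itself can be prepared
   from p copies of psi1 for some p.  Hence psi1^(km+p) -> psi2^(kn) without
   catalyst, at rate kn/(km+p), which tends to n/m. *)

Require Import Defs.
From mathcomp Require Import all_boot all_order all_fingroup all_algebra.
From mathcomp Require Import complex mxtens.
From mathcomp Require Import boolp classical_sets reals ereal.
From mathcomp Require Import ring lra.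

Set Implicit Arguments.
Unset Strict Implicit.
Unset Printing Implicit Defensive.

Import Order.TTheory GRing.Theory Num.Theory.

Local Open Scope ring_scope.

(** * Majorization through hockey-stick sums *)

Section Sequences.
Variable R : realType.
Implicit Types (s t r : seq R) (x y z e : R).

Definition hockey x s : R := \sum_(y <- s) Num.max (y - x) 0.

Definition hockey_le s t := forall x, 0 <= x -> hockey x s <= hockey x t.

Lemma hockey_le_trans t s r : hockey_le s t -> hockey_le t r -> hockey_le s r.
Proof. by move=> st tr x x0; apply: le_trans (st _ x0) (tr _ x0). Qed.

(** An entry y is at most x + max(y - x, 0), and the terms of the hockey sum that are left over are
    nonnegative. The zero padding is covered by x >= 0. *)
Lemma sum_le_hockey s n x : 0 <= x ->
  \sum_(k < n) s`_k <= n%:R * x + hockey x s.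
Proof.
move=> x0; elim: n s => [|n IHn] [|y s].
- by rewrite big_ord0 /hockey big_nil mul0r addr0.
- by rewrite big_ord0 mul0r add0r sumr_ge0 // => z _; rewrite le_max lexx orbT.
- rewrite big1 => [|k _]; last by rewrite nth_nil.
  by rewrite /hockey big_nil addr0 mulr_ge0.
rewrite big_ord_recl /= /hockey big_cons; under eq_bigr do rewrite add0n.
have := IHn s; rewrite /hockey -natr1 => IH.
have : y - x <= Num.max (y - x) 0 by rewrite le_max lexx.
lra.
Qed.

(** Equality case of the bound above: at the threshold t_n each k < n contributes t_k - t_n and
    every later entry contributes 0. *)
Lemma sum_eq_hockey t n : sorted >=%R t -> all (>= 0) t ->
  \sum_(k < n) t`_k = n%:R * t`_n + hockey t`_n t.
Proof.
move=> ts /allP t0.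
have t_ge0 k : 0 <= t`_k.
  by case: (ltnP k (size t)) => [/(mem_nth 0)/t0//|/(nth_default 0)->].
have tle i j : (i <= j)%N -> t`_j <= t`_i.
  move=> ij; case: (ltnP j (size t)) => [jt|/(nth_default 0)->//].
  have := sorted_leq_nth (rev_trans le_trans) lexx 0 ts.
  by apply=> //; rewrite inE // (leq_ltn_trans ij).
(* Since n may lie past the end of t, the hockey sum is padded with zero entries, each adding max(0
   - t_n, 0) = 0. *)
have hE N : (size t <= N)%N -> hockey t`_n t = \sum_(0 <= k < N) Num.max (t`_k - t`_n) 0.
  move=> tN; rewrite /hockey (big_nth 0) [RHS](big_cat_nat (n := size t)) //=.
  rewrite [X in _ = _ + X]big1_seq ?addr0 // => k /=.
  rewrite mem_index_iota => /andP[tk _].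
  by rewrite (nth_default _ tk) sub0r; apply: max_r; rewrite oppr_le0.
rewrite (hE (maxn n (size t))) ?leq_maxr // (big_cat_nat (n := n)) ?leq_maxl //=.
rewrite [X in _ + (_ + X)]big1_seq ?addr0 => [|k /=]; last first.
  rewrite mem_index_iota => /andP[nk _].
  by apply: max_r; rewrite subr_le0 tle.
rewrite big_mkord; have -> : n%:R * t`_n = \sum_(k < n) t`_n.
  by rewrite sumr_const card_ord mulr_natl.
rewrite -big_split /=.
apply: eq_bigr => k _; rewrite max_l ?subr_ge0 ?tle 1?ltnW //.
by rewrite addrC subrK.
Qed.

Lemma hockey_majorized s t : sorted >=%R t -> all (>= 0) t ->
  hockey_le s t -> majorized s t.
Proof.
move=> ts t0 st n; rewrite (sum_eq_hockey n ts t0).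
have tn : 0 <= t`_n.
  by case: (ltnP n (size t)) => [/(mem_nth 0)/(allP t0)//|/(nth_default 0)->].
by apply: le_trans (sum_le_hockey s n tn) _; rewrite lerD2l st.
Qed.

(** In a nonincreasing list the entries above x form an initial segment. *)
Lemma hockey_count s x : sorted >=%R s ->
  hockey x s = \sum_(k < count (fun y => x < y) s) (s`_k - x).
Proof.
elim: s => [|y s IHs] ss; first by rewrite /hockey big_nil big_ord0.
rewrite /hockey big_cons /=; case: (ltP x y) => xy.
  rewrite add1n big_ord_recl /= max_l ?subr_ge0 1?ltW //; congr (_ + _).
  by rewrite -/(hockey x s) IHs // (path_sorted ss).
have le_y : {in s, forall z, z <= y}.
  move: ss; rewrite /= path_sortedE; last exact: rev_trans le_trans.
  by case/andP=> /allP.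
rewrite add0n (eqP (_ : count _ s == 0)%N) ?big_ord0.
  rewrite max_r ?subr_le0 // add0r big1_seq // => z /= /le_y zy.
  by apply: max_r; rewrite subr_le0 (le_trans zy).
rewrite -leqn0 leqNgt -has_count; apply/hasPn => z /le_y zy.
by rewrite -leNgt (le_trans zy).
Qed.

(** Partial sums are compared at the length where the hockey sum of s is exactly its partial sum
    minus n * x. *)
Lemma majorized_hockey s t : sorted >=%R s -> majorized s t -> hockey_le s t.
Proof.
move=> ss st x x0; rewrite (hockey_count x ss); set n := count _ s.
rewrite sumrB sumr_const card_ord -mulr_natl lerBlDl.
exact: le_trans (st n) (sum_le_hockey t n x0).
Qed.

(** * Tensor products of coefficient lists *)

Definition tens s t : seq R := [seq x * y | x <- s, y <- t].

Definition spow s n := iter n (tens s) [:: 1].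

Lemma big_tens (g : R -> R) s t :
  \sum_(z <- tens s t) g z = \sum_(x <- s) \sum_(y <- t) g (x * y).
Proof. by rewrite /tens big_allpairs_dep. Qed.

Lemma sum_tens s t :
  \sum_(z <- tens s t) z = (\sum_(x <- s) x) * (\sum_(y <- t) y).
Proof. by rewrite big_tens mulr_suml; apply: eq_bigr => x _; rewrite mulr_sumr. Qed.

Lemma tensA : associative tens.
Proof.
have tens_map x t r : tens (map ( *%R x) t) r = map ( *%R x) (tens t r).
  elim: t => //= y t IHt; rewrite /tens !allpairs_cons map_cat -/(tens t r) -IHt.
  by congr (_ ++ _); rewrite -map_comp; apply: eq_map => z /=; rewrite mulrA.
elim=> // x s IHs t r; rewrite /tens !allpairs_cons allpairs_cat.
by rewrite -!/(tens _ _) tens_map IHs.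
Qed.

Lemma tens1 : right_id [:: 1] tens.
Proof. by elim=> //= x s IHs; rewrite /tens allpairs_cons -/(tens _ _) IHs /= mulr1. Qed.

Lemma onetens : left_id [:: 1] tens.
Proof.
move=> s; rewrite /tens /= cats0 -[RHS]map_id.
by apply: eq_map => x; rewrite mul1r.
Qed.

Lemma spowD s m n : spow s (m + n) = tens (spow s m) (spow s n).
Proof.
elim: m => [|m IHm]; first by rewrite onetens.
by rewrite addSn /= -tensA -IHm.
Qed.

Lemma tens_ge0 s t : all (>= 0) s -> all (>= 0) t -> all (>= 0) (tens s t).
Proof.
move=> /allP s0 /allP t0; apply/allP => _ /allpairsP[[x y] /= [/s0 x0 /t0 y0 ->]].
exact: mulr_ge0.
Qed.

Lemma spow_ge0 s n : all (>= 0) s -> all (>= 0) (spow s n).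
Proof.
move=> s0; elim: n => [|n IHn] /=; first by rewrite ler01.
exact: tens_ge0.
Qed.

Lemma sum_spow s n : \sum_(x <- s) x = 1 -> \sum_(x <- spow s n) x = 1.
Proof.
move=> s1; elim: n => [|n IHn] /=; first by rewrite big_seq1.
by rewrite sum_tens s1 IHn mulr1.
Qed.

Lemma hockey_tensC x s t : hockey x (tens s t) = hockey x (tens t s).
Proof.
rewrite /hockey !big_tens exchange_big /=.
by apply: eq_bigr => y _; apply: eq_bigr => z _; rewrite mulrC.
Qed.

(** By homogeneity, a factor y > 0 only rescales the threshold. Hence an order required at all
    thresholds survives tensoring. *)
Lemma hockey_tens_posE x y s : 0 < y ->
  \sum_(z <- s) Num.max (y * z - x) 0 = y * hockey (x / y) s.
Proof.
move=> y0; rewrite /hockey mulr_sumr; apply: eq_bigr => z _.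
by rewrite maxr_pMr ?ltW // mulr0 mulrBr mulrCA divff ?mulr1 // gt_eqF.
Qed.

Lemma hockey_le_tensl r s t : all (>= 0) r ->
  hockey_le s t -> hockey_le (tens r s) (tens r t).
Proof.
move=> /allP r0 st x x0; rewrite /hockey !big_tens big_seq [leRHS]big_seq.
apply: ler_sum => y /r0; rewrite le_eqVlt => /predU1P[<-|y0].
  have z0 (u : seq R) : \sum_(z <- u) Num.max (0 * z - x) 0 = 0.
    by rewrite big1 // => z _; rewrite mul0r sub0r; apply: max_r; rewrite oppr_le0.
  by rewrite !z0.
rewrite !hockey_tens_posE // ler_pM2l //; apply: st.
by rewrite divr_ge0 // ltW.
Qed.

Lemma hockey_le_tensr r s t : all (>= 0) r ->
  hockey_le s t -> hockey_le (tens s r) (tens t r).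
Proof.
move=> r0 st x x0; rewrite hockey_tensC [leRHS]hockey_tensC.
exact: hockey_le_tensl.
Qed.

Lemma hockey_tensCA x s t r :
  hockey x (tens s (tens t r)) = hockey x (tens t (tens s r)).
Proof.
rewrite !tensA /hockey [LHS]big_tens [RHS]big_tens.
have E (g : R -> R) : \sum_(z <- tens s t) g z = \sum_(z <- tens t s) g z.
  rewrite !big_tens exchange_big /=.
  by apply: eq_bigr => y _; apply: eq_bigr => z _; rewrite mulrC.
exact: E.
Qed.

Lemma mem_le_sum s x : all (>= 0) s -> x \in s -> x <= \sum_(y <- s) y.
Proof.
move=> s0 xs; rewrite (perm_big _ (perm_to_rem xs)) big_cons lerDl.
rewrite big_seq; apply: sumr_ge0 => y /mem_rem; exact/allP.
Qed.

(** Tensoring with r splits each entry z into pieces z * y whose weights y sum to 1, and max(z * y -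
    x, 0) <= y * max(z - x, 0) because y <= 1. In terms of states, a factor may be thrown away. *)
Lemma hockey_le_discard s r : all (>= 0) r -> \sum_(y <- r) y = 1 ->
  hockey_le (tens s r) s.
Proof.
move=> r0 r1 x x0; rewrite /hockey big_tens; apply: ler_sum => z _.
have -> : Num.max (z - x) 0 = \sum_(y <- r) y * Num.max (z - x) 0.
  by rewrite -mulr_suml r1 mul1r.
rewrite big_seq [leRHS]big_seq; apply: ler_sum => y yr.
have y0 : 0 <= y by move: yr; apply/allP.
have y1 : y <= 1 by rewrite -r1 mem_le_sum.
rewrite maxr_pMr // mulr0 ge_max !le_max lexx !orbT andbT.
by apply/orP; left; nra.
Qed.

(* Both sides are compared with 1 - x / e: the map y |-> max (y - x) 0 lies below
   y |-> y * (1 - x / e) on [0, e] and above it on [e, +oo[ and at 0. *)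
Lemma hockey_le_flat s r e : 0 < e ->
    all (>= 0) s -> \sum_(y <- s) y = 1 -> {in s, forall y, y <= e} ->
    all (>= 0) r -> \sum_(y <- r) y = 1 -> {in r, forall y, y != 0 -> e <= y} ->
  hockey_le s r.
Proof.
move=> e0 /allP s0 s1 se /allP r0 r1 re x x0.
case: (leP e x) => xe.
  rewrite /hockey big1_seq => [|y /= /se ye]; last first.
    by apply: max_r; rewrite subr_le0 (le_trans ye).
  by apply: sumr_ge0 => z _; rewrite le_max lexx orbT.
have xe1 : x / e < 1 by rewrite ltr_pdivrMr // mul1r.
have xe0 : 0 <= x / e by rewrite divr_ge0 // ltW.
have xE : x = x / e * e by rewrite divfK // gt_eqF.
apply: (@le_trans _ _ (1 - x / e)).
  rewrite -[1 - _]mul1r -s1 mulr_suml /hockey big_seq [leRHS]big_seq.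
  apply: ler_sum => y ys; have := s0 _ ys; have := se _ ys => ye /= y0.
  by rewrite ge_max; apply/andP; split; nra.
rewrite -[1 - _]mul1r -r1 mulr_suml /hockey big_seq [leRHS]big_seq.
apply: ler_sum => y yr; have /= := r0 _ yr; rewrite le_eqVlt => /predU1P[<-|y0].
  by rewrite mul0r le_max lexx orbT.
have ey : e <= y by apply: re; rewrite ?gt_eqF.
by rewrite le_max; apply/orP; left; nra.
Qed.

(** * Schmidt rank and decay of tensor powers *)

Definition rk s := count (fun x => x != 0) s.

Lemma rk_tens s t : rk (tens s t) = (rk s * rk t)%N.
Proof.
elim: s => // x s IHs.
rewrite /tens allpairs_cons /rk count_cat -/(tens s t) -/(rk _) -/(rk (tens _ _)) IHs /=.
rewrite mulnDl; congr (_ + _)%N; rewrite /rk count_map.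
case: eqP => [->|/eqP x0] /=; last first.
  by rewrite mul1n; apply: eq_count => y; rewrite /= mulf_eq0 (negPf x0).
by rewrite mul0n (@eq_count _ _ pred0) ?count_pred0 // => y; rewrite /= mul0r eqxx.
Qed.

Lemma rk_spow s n : rk (spow s n) = (rk s ^ n)%N.
Proof. by elim: n => [|n IHn] /=; rewrite ?rk_tens ?IHn ?expnS /rk //= oner_eq0. Qed.

(** Used twice: as a threshold below all nonzero entries in the rank bound, and as the size to which
    the entries of a tensor power must shrink before it can be converted into the catalyst. *)
Lemma lower_bound_pos s : all (>= 0) s ->
  exists2 e, 0 < e & {in s, forall y, y != 0 -> e <= y}.
Proof.
elim: s => [|x s IHs] /= => [_|/andP[x0 /IHs[e e0 es]]]; first by exists 1.
case: (eqVneq x 0) => [x00|xn0].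
  by exists e => // y; rewrite inE => /predU1P[->|/es//]; rewrite x00 eqxx.
exists (Num.min e x); first by rewrite lt_min e0 lt_def xn0.
by move=> y; rewrite inE ge_min => /predU1P[->|/es ey /ey->//]; rewrite lexx orbT.
Qed.

(* For x below every nonzero entry of t, h_x(t) = sum t - x * rk t. *)
Lemma hockey_le_rk s t : all (>= 0) s -> all (>= 0) t ->
  \sum_(x <- s) x = \sum_(x <- t) x -> hockey_le s t -> (rk t <= rk s)%N.
Proof.
move=> s0 t0 st hst; have [e e0 te] := lower_bound_pos t0.
have sumE r : \sum_(x <- r) x - (rk r)%:R * e =
    \sum_(x <- r) (if x != 0 then x - e else 0).
  rewrite -big_mkcond sumrB big_const_seq -Monoid.iteropE /= mulr_natl.
  by rewrite [in RHS]big_mkcond; congr (_ - _); apply: eq_bigr => x _; case: eqP.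
have := hst e (ltW e0) => h.
have hs : \sum_(x <- s) x - (rk s)%:R * e <= hockey e s.
  rewrite sumE; apply: ler_sum => x _; rewrite le_max.
  by case: ifP; rewrite lexx ?orbT.
have ht : hockey e t = \sum_(x <- t) x - (rk t)%:R * e.
  rewrite sumE /hockey !big_seq; apply: eq_bigr => x xt.
  case: (eqVneq x 0) => [->|x0] /=.
    by apply: max_r; rewrite sub0r oppr_le0 ltW.
  by apply: max_l; rewrite subr_ge0 te.
by rewrite -(ler_nat R) -(ler_pM2r e0); lra.
Qed.

Lemma mem_lt1 s x : all (>= 0) s -> \sum_(y <- s) y = 1 -> (2 <= rk s)%N ->
  x \in s -> x < 1.
Proof.
move=> s0 s1 s2 xs.
move: s1 s2; rewrite (perm_big _ (perm_to_rem xs)) big_cons /=.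
rewrite /rk (seq.permP (perm_to_rem xs)) /= => s1 s2.
have : has (fun y => y != 0) (rem x s).
  by rewrite has_count; case: (x != 0) s2 => //; apply: ltnW.
case/hasP=> y ys y0.
have r0 : all (>= 0) (rem x s) by apply/allP => z /mem_rem; apply/allP.
have := mem_le_sum r0 ys.
have : 0 < y by rewrite lt_def y0; move: y ys {y0}; apply/allP.
lra.
Qed.

(** All entries of s are bounded by some q < 1, so those of the n-th power are bounded by q ^ n,
    which tends to 0. *)
Lemma spow_small s e : 0 < e -> all (>= 0) s -> \sum_(y <- s) y = 1 ->
  (2 <= rk s)%N -> exists n, {in spow s n, forall y, y <= e}.
Proof.
move=> e0 s0 s1 s2.
have [q [q0 q1 sq]] : exists q, [/\ 0 <= q, q < 1 & {in s, forall y, y <= q}].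
  have : {in s, forall y, y < 1} by move=> y; apply: mem_lt1.
  elim: s {s0 s1 s2} => [|x s IHs] sl; first by exists 0.
  have [y ys|q [q0 q1 sq]] := IHs; first by apply: sl; rewrite inE ys orbT.
  exists (Num.max x q); split.
  - by rewrite le_max q0 orbT.
  - by rewrite gt_max q1 sl // inE eqxx.
  by move=> y; rewrite inE le_max => /predU1P[->|/sq->]; rewrite ?lexx ?orbT.
have pq n : {in spow s n, forall y, y <= q ^+ n}.
  elim: n => [|n IHn] y /=; first by rewrite inE => /eqP->.
  case/allpairsP=> -[u v] /= [us vs ->]; rewrite exprS.
  by apply: ler_pM; rewrite ?sq ?IHn //; [apply: (allP s0)|apply: (allP (spow_ge0 n s0))].
have [n qn] : exists n, q ^+ n <= e.
  (* A Bernoulli-type bound: with d = 1 - q, one has q * (1 + (n + 1) * d) = 1 + n * d - (n + 1) * d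
     ^ 2. *)
  have qB n : q ^+ n * (1 + n%:R * (1 - q)) <= 1.
    elim: n => [|n IHn]; first by rewrite expr0 mul0r addr0 mulr1.
    apply: le_trans IHn; rewrite exprSr -mulrA ler_wpM2l ?exprn_ge0 // -natr1.
    have := mulr_ge0 (ler0n R n) (sqr_ge0 (1 - q)); have := sqr_ge0 (1 - q).
    by rewrite expr2; nra.
  have d0 : 0 < 1 - q by rewrite subr_gt0.
  have := @archi_boundP _ (e * (1 - q))^-1; rewrite invr_ge0 mulr_ge0 ?ltW // => /(_ isT).
  set n := Num.bound _ => hn; exists n.
  (* If q ^ n exceeded e, then n * q ^ n * (1 - q) would exceed 1, against [qB]. *)
  have {}hn : 1 < n%:R * (e * (1 - q)) by rewrite -ltr_pdivrMr ?mulr_gt0 // div1r.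
  have := qB n; have : 0 <= q ^+ n by rewrite exprn_ge0.
  have : 0 <= n%:R :> R by [].
  move: hn; set a := q ^+ n; set N := n%:R => hn N0 a0 han.
  rewrite leNgt; apply/negP => ea.
  have : N * (e * (1 - q)) <= N * (a * (1 - q)) by rewrite ler_wpM2l // ler_wpM2r ?ltW.
  lra.
by exists n => y /pq /le_trans; apply.
Qed.

(** * Iteration and removal of the catalyst *)

Lemma catalysis_iter s t r m n k : all (>= 0) s -> all (>= 0) t ->
    hockey_le (tens (spow s m) r) (tens (spow t n) r) ->
  hockey_le (tens (spow s (k * m)) r) (tens (spow t (k * n)) r).
Proof.
move=> s0 t0 st; elim: k => [|k IHk]; first by rewrite !mul0n => x.
rewrite !mulSn !spowD -!tensA => x x0.
(* The first k rounds run beside m idle copies of s and give r back. Then r is regrouped with these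
   copies for one more round, beside the copies of t already made. *)
apply: le_trans (hockey_le_tensl (spow_ge0 m s0) IHk x0) _.
rewrite hockey_tensCA [leRHS]hockey_tensCA.
exact: hockey_le_tensl (spow_ge0 _ t0) st x x0.
Qed.

(** The chain is s^(km) s^p -> s^(km) r -> t^(kn) r -> t^(kn), built below from its last link. The
    overhead p depends on s and r but not on k, so it is amortized as k grows. *)
Lemma catalysis_removal s t r m n :
    all (>= 0) s -> \sum_(x <- s) x = 1 -> (2 <= rk s)%N ->
    all (>= 0) t -> all (>= 0) r -> \sum_(x <- r) x = 1 ->
    hockey_le (tens (spow s m) r) (tens (spow t n) r) ->
  exists p, forall k, hockey_le (spow s (k * m + p)) (spow t (k * n)).
Proof.
move=> s0 s1 s2 t0 r0 r1 st.
have [e e0 re] := lower_bound_pos r0.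
have [p sp] := spow_small e0 s0 s1 s2.
exists p => k; rewrite spowD.
apply: hockey_le_trans (hockey_le_discard _ r0 r1).
apply: hockey_le_trans (catalysis_iter k s0 t0 st).
apply: hockey_le_tensl; first exact: spow_ge0.
by apply: (hockey_le_flat e0) => //; [apply: spow_ge0|apply: sum_spow].
Qed.

End Sequences.

(** * Orthonormal frames *)

Section Adjoint.
Variable R : realType.
Local Notation C := R[i].

Definition adjmx m n (A : 'M[C]_(m, n)) : 'M[C]_(n, m) := map_mx Num.conj A^T.

Lemma adjmxE m n (A : 'M[C]_(m, n)) i j : adjmx A i j = (A j i)^*.
Proof. by rewrite !mxE. Qed.

Lemma adjmxK m n (A : 'M[C]_(m, n)) : adjmx (adjmx A) = A.
Proof. by apply/matrixP => i j; rewrite !mxE conjCK. Qed.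

Lemma adjmxM m n p (A : 'M[C]_(m, n)) (B : 'M[C]_(n, p)) :
  adjmx (A *m B) = adjmx B *m adjmx A.
Proof. by rewrite /adjmx trmx_mul map_mxM. Qed.

Lemma unitaryP m n (A : 'M[C]_(m, n)) :
  reflect (A *m adjmx A = 1%:M) (A \is unitarymx).
Proof. exact: unitarymxP. Qed.

Lemma adjmx_tens m n p q (A : 'M[C]_(m, n)) (B : 'M[C]_(p, q)) :
  adjmx (A *t B) = adjmx A *t adjmx B.
Proof. by rewrite /adjmx trmx_tens map_mxT. Qed.

Lemma tens_unitary m n p q (A : 'M[C]_(m, n)) (B : 'M[C]_(p, q)) :
  A \is unitarymx -> B \is unitarymx -> A *t B \is unitarymx.
Proof.
move=> /unitaryP uA /unitaryP uB; apply/unitaryP.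
rewrite adjmx_tens tensmx_mul uA uB; apply/matrixP => i j.
case: (mxtens_indexP i) => i1 i2; case: (mxtens_indexP j) => j1 j2.
rewrite tensmxE !mxE (can_eq (@mxtens_indexK _ _)) xpair_eqE.
by case: eqP => _; case: eqP => _; rewrite ?(mul0r, mulr0, mulr1).
Qed.

(** Squared modulus with values in [R], so that it can weight real hockey sums. *)
Definition sqn (z : C) : R := complex.Re z ^+ 2 + complex.Im z ^+ 2.

Lemma sqn_ge0 z : 0 <= sqn z.
Proof. by rewrite addr_ge0 ?sqr_ge0. Qed.

Lemma sqn_eq0 z : (sqn z == 0) = (z == 0).
Proof. by case: z => x y; rewrite /sqn /= paddr_eq0 ?sqr_ge0 // !sqrf_eq0 eq_complex. Qed.

Lemma sqnE z : (sqn z)%:C%C = z * z^*.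
Proof.
case: z => x y; rewrite /sqn /=; apply/eqP; rewrite eq_complex /=.
by apply/andP; split; apply/eqP; ring.
Qed.

Lemma sqn_conj z : sqn z^* = sqn z.
Proof. by case: z => x y; rewrite /sqn /= sqrrN. Qed.

Lemma mulmx_adj_diag m n (A : 'M[C]_(m, n)) i :
  (A *m adjmx A) i i = (\sum_j sqn (A i j))%:C%C.
Proof.
rewrite mxE rmorph_sum; apply: eq_bigr => j _.
by rewrite adjmxE /= -sqnE.
Qed.

(** The rows of W *m V are the projections of the rows of U onto the row span of V. The residual X
    has Gram matrix 1 - W W^*, whose diagonal is nonnegative. *)
Lemma bessel m n p (U : 'M[C]_(m, p)) (V : 'M[C]_(n, p)) i :
  U \is unitarymx -> V \is unitarymx ->
  \sum_j sqn ((U *m adjmx V) i j) <= 1.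
Proof.
move=> /unitaryP uU /unitaryP uV; set W := U *m adjmx V.
pose X := U - W *m V.
have XX : X *m adjmx X = 1%:M - W *m adjmx W.
  have XV : X *m adjmx V = 0 by rewrite mulmxBl -/W -mulmxA uV mulmx1 subrr.
  have aX : adjmx X = adjmx U - adjmx V *m adjmx W.
    by rewrite -adjmxM; apply/matrixP => k l; rewrite !mxE rmorphB.
  rewrite aX mulmxBr mulmxA XV mul0mx subr0 mulmxBl uU.
  by congr (_ - _); rewrite /W adjmxM adjmxK -!mulmxA.
have h : 1 - \sum_j sqn (W i j) = \sum_j sqn (X i j).
  apply: (fmorph_inj (real_complex R)).
  rewrite rmorphB rmorph1 /= -!mulmx_adj_diag XX [RHS]mxE [in RHS]mxE eqxx.
  by congr (_ + _); rewrite [RHS]mxE.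
by rewrite -subr_ge0 h sumr_ge0 // => j _; apply: sqn_ge0.
Qed.

End Adjoint.

(** * Schmidt decompositions *)

Section Schmidt.
Variable R : realType.
Local Notation C := R[i].

(* Same as schmidt_coefs, except that s need not be sorted. *)
Definition svd a b (psi : 'M[C]_(a, b)) (s : seq R) : Prop :=
  all (>= 0) s /\
  exists (U : 'M[C]_(size s, a)) (V : 'M[C]_(size s, b)),
    [/\ U \is unitarymx, V \is unitarymx &
      psi = U^T *m diag_mx (\row_k (Num.sqrt s`_k)%:C%C) *m V].

Lemma svd_ge0 a b (psi : 'M[C]_(a, b)) s : svd psi s -> all (>= 0) s.
Proof. by case. Qed.

Lemma mul_tr_diag_mx n a b (U : 'M[C]_(n, a)) d (V : 'M[C]_(n, b)) x y :
  (U^T *m diag_mx d *m V) x y = \sum_k d 0 k * (U k x * V k y).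
Proof.
rewrite mul_mx_diag mxE; apply: eq_bigr => k _.
by rewrite !mxE [_ * d _ _]mulrC mulrA.
Qed.

(** Allows frames indexed by any n provably equal to [size s], which avoids casts. *)
Lemma svdI n a b (psi : 'M[C]_(a, b)) s (U : 'M[C]_(n, a)) (V : 'M[C]_(n, b)) :
    size s = n -> all (>= 0) s -> U \is unitarymx -> V \is unitarymx ->
    psi = U^T *m diag_mx (\row_k (Num.sqrt s`_k)%:C%C) *m V ->
  svd psi s.
Proof.
move=> sn; case: n / sn in U V *; move=> s0 uU uV ->.
by split=> //; exists U, V.
Qed.

Lemma schmidt_coefsE a b (psi : 'M[C]_(a, b)) s :
  schmidt_coefs psi s <-> sorted >=%R s /\ svd psi s.
Proof.
have E (U : 'M[C]_(size s, a)) (V : 'M[C]_(size s, b)) :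
    \sum_(k < size s) (Num.sqrt s`_k)%:C%C *: ((row k U)^T *m row k V) =
    U^T *m diag_mx (\row_k (Num.sqrt s`_k)%:C%C) *m V.
  apply/matrixP => x y; rewrite mul_tr_diag_mx summxE.
  by apply: eq_bigr => k _; rewrite !mxE big_ord1 !mxE.
split=> [[ss s0 [U [V [uU uV ->]]]]|[ss [s0 [U [V [uU uV ->]]]]]].
  by split=> //; split=> //; exists U, V; rewrite E.
by split=> //; exists U, V; rewrite E.
Qed.

(** The permutation that sorts s is applied to the rows of both frames. *)
Lemma svd_sort a b (psi : 'M[C]_(a, b)) s :
  svd psi s -> svd psi (sort >=%R s).
Proof.
case=> s0 [U [V [uU uV ->]]].
have /(@tuple_permP _ _ _ (in_tuple s)) [p sp] : perm_eq (sort >=%R s) s.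
  by rewrite perm_sort.
have up m (W : 'M[C]_(size s, m)) : W \is unitarymx -> row_perm p W \is unitarymx.
  move=> /unitaryP uW; apply/unitaryP/matrixP => i j.
  have -> : (row_perm p W *m adjmx (row_perm p W)) i j = (W *m adjmx W) (p i) (p j).
    by rewrite !mxE; apply: eq_bigr => k _; rewrite !mxE.
  by rewrite uW !mxE (inj_eq perm_inj).
apply: (svdI (U := row_perm p U) (V := row_perm p V)).
- by rewrite size_sort.
- by rewrite all_sort.
- exact: up.
- exact: up.
apply/matrixP => x y; rewrite !mul_tr_diag_mx (reindex_inj (@perm_inj _ p)) /=.
apply: eq_bigr => k _; rewrite !mxE sp.
by rewrite (nth_mktuple _ 0 k) (tnth_nth 0).
Qed.

(** This is the reduced state of the first party: the orthonormal frame V cancels, and the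
    coefficients appear as eigenvalues without square roots. *)
Lemma svd_gram a b (psi : 'M[C]_(a, b)) s : svd psi s ->
  exists2 U : 'M[C]_(size s, a), U \is unitarymx &
    psi *m adjmx psi = adjmx U *m diag_mx (\row_k (s`_k)%:C%C) *m U.
Proof.
case=> /allP s0 [U [V [uU /unitaryP uV ->]]].
(* The decomposition involves U^T rather than U^*, hence the conjugated frame. *)
exists (map_mx Num.conj U); first by rewrite conjC_unitary.
have -> : adjmx (map_mx Num.conj U) = U^T.
  by apply/matrixP => i j; rewrite !mxE conjCK.
set D := diag_mx _; rewrite !adjmxM.
have -> : adjmx U^T = map_mx Num.conj U by apply/matrixP => i j; rewrite !mxE.
transitivity (U^T *m (D *m ((V *m adjmx V) *m adjmx D)) *m map_mx Num.conj U).
  by rewrite !mulmxA.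
rewrite uV mul1mx; congr (_ *m _ *m _); rewrite {}/D.
have -> : adjmx (diag_mx (\row_k (Num.sqrt s`_k)%:C%C)) =
    diag_mx (\row_(k < size s) (Num.sqrt s`_k)%:C%C).
  apply/matrixP => i j; rewrite !mxE eq_sym; case: eqP => [->|_]; last by rewrite conjC0.
  by rewrite mulr1n; apply: conjc_real.
rewrite mulmx_diag; congr diag_mx; apply/rowP => k; rewrite !mxE -rmorphM -expr2.
by rewrite sqr_sqrtr // s0 // mem_nth.
Qed.

Lemma hockey_nth x (s : seq R) :
  hockey x s = \sum_(k < size s) Num.max (s`_k - x) 0.
Proof. by rewrite /hockey (big_nth 0) big_mkord. Qed.

(* The squared moduli of the overlaps of the two left frames form a doubly
   substochastic matrix (Bessel) that sends t to s. *)
Lemma svd_hockey_le a b (psi : 'M[C]_(a, b)) s t :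
  svd psi s -> svd psi t -> hockey_le s t.
Proof.
move=> /svd_gram [U uU hU] /[dup] /svd_ge0 /allP t0 /svd_gram [V uV hV] x x0.
set p := fun j k => sqn ((U *m adjmx V) j k).
have sE (j : 'I_(size s)) : s`_j = \sum_(k < size t) p j k * t`_k.
  apply: (fmorph_inj (real_complex R)); rewrite rmorph_sum /=.
  transitivity ((U *m (psi *m adjmx psi) *m adjmx U) j j).
    rewrite hU !mulmxA (unitaryP _ uU) mul1mx -mulmxA (unitaryP _ uU) mulmx1.
    by rewrite !mxE eqxx.
  have -> : U *m (psi *m adjmx psi) *m adjmx U = (U *m adjmx V) *m
      diag_mx (\row_k (t`_k)%:C%C) *m adjmx (U *m adjmx V).
    by rewrite hV adjmxM adjmxK !mulmxA.
  rewrite mul_mx_diag [LHS]mxE; apply: eq_bigr => k _.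
  rewrite adjmxE /p; move: (U *m adjmx V) => W.
  by rewrite !mxE rmorphM /= sqnE mulrAC.
rewrite !hockey_nth.
apply: (@le_trans _ _
  (\sum_(j < size s) \sum_(k < size t) p j k * Num.max (t`_k - x) 0)).
  apply: ler_sum => j _; rewrite ge_max; apply/andP; split; last first.
    by apply: sumr_ge0 => k _; rewrite mulr_ge0 ?sqn_ge0 // le_max lexx orbT.
  apply: (@le_trans _ _ (\sum_(k < size t) p j k * (t`_k - x))); last first.
    by apply: ler_sum => k _; rewrite ler_wpM2l ?sqn_ge0 // le_max lexx.
  rewrite sE; under [leRHS]eq_bigr do rewrite mulrBr.
  by rewrite sumrB lerB // -mulr_suml ler_piMl // bessel.
rewrite exchange_big /=; apply: ler_sum => k _; rewrite -mulr_suml.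
rewrite ler_piMl ?le_max ?lexx ?orbT //.
have := bessel k uV uU; apply: le_trans; apply: ler_sum => j _.
rewrite /p -(sqn_conj (_ j k)) -adjmxE adjmxM adjmxK.
exact: lexx.
Qed.

(** Both sides are the trace of the reduced state. *)
Lemma svd_sum a b (psi : 'M[C]_(a, b)) s :
  is_state psi -> svd psi s -> \sum_(x <- s) x = 1.
Proof.
move=> psi1 /svd_gram [U /unitaryP uU hU]; apply: (fmorph_inj (real_complex R)).
rewrite rmorph1 rmorph_sum -[RHS]psi1.
transitivity (\tr (psi *m adjmx psi)).
  rewrite hU -mulmxA mxtrace_mulC -mulmxA uU mulmx1 mxtrace_diag.
  by rewrite (big_nth 0) big_mkord; apply: eq_bigr => k _; rewrite mxE.
apply: eq_bigr => i _; rewrite mxE; apply: eq_bigr => j _.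
by rewrite adjmxE normCK.
Qed.

(** Diagonalizing psi psi^* by a unitary P makes the rows of B = P psi orthogonal. Their squared
    norms are the coefficients, the normalized rows form V, and the conjugated rows of P form U. *)
Lemma svd_exists a b (psi : 'M[C]_(a, b)) : exists s, svd psi s.
Proof.
set A := psi *m adjmx psi.
have adjA : adjmx A = A by rewrite adjmxM adjmxK.
have /orthomx_spectralP : A \is normalmx.
  by apply/normalmxP; rewrite -[map_mx _ _]/(adjmx A) adjA.
have := spectral_unitarymx A; set P := spectralmx A; move: (spectral_diag A) => d uP.
rewrite invmx_unitary // -/(adjmx P) => hA.
set B := P *m psi.
have psiE : psi = adjmx P *m B by rewrite mulmxA (mulmx1C (unitaryP _ uP)) mul1mx.
have BB : B *m adjmx B = diag_mx d.
  transitivity (P *m A *m adjmx P); first by rewrite adjmxM !mulmxA.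
  by rewrite hA !mulmxA (unitaryP _ uP) mul1mx -mulmxA (unitaryP _ uP) mulmx1.
pose f k := \sum_y sqn (B k y).
have f0 k : 0 <= f k by apply: sumr_ge0 => y _; apply: sqn_ge0.
have Bij i j : (B *m adjmx B) i j = (f i)%:C%C *+ (i == j).
  case: eqP => [<-|/eqP ij]; first by rewrite mulmx_adj_diag mulr1n.
  by rewrite BB mxE (negPf ij).
(* Zero rows of B cannot be normalized; only the indices in K enter the decomposition. *)
pose K := [pred k | f k != 0].
have fK (i : 'I_#|K|) : f (enum_val i) != 0 by have := enum_valP i.
pose s := [seq f (enum_val i) | i <- enum 'I_#|K|].
have sE (i : 'I_#|K|) : s`_i = f (enum_val i).
  by rewrite (nth_map i) ?size_enum_ord // nth_ord_enum.
exists s; apply: (svdI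
  (U := \matrix_(i < #|K|, x < a) (P (enum_val i) x)^*)
  (V := \matrix_(i < #|K|, y < b)
    ((Num.sqrt (f (enum_val i)))^-1%:C%C * B (enum_val i) y))).
- by rewrite size_map size_enum_ord.
- by apply/allP => _ /mapP[i _ ->].
- apply/unitaryP/matrixP => i j.
  transitivity (((P *m adjmx P) (enum_val i) (enum_val j))^*).
    by rewrite !mxE rmorph_sum; apply: eq_bigr => x _; rewrite !mxE rmorphM.
  by rewrite (unitaryP _ uP) !mxE (inj_eq enum_val_inj) conjC_nat.
- apply/unitaryP/matrixP => i j.
  transitivity ((Num.sqrt (f (enum_val i)))^-1%:C%C *
      (Num.sqrt (f (enum_val j)))^-1%:C%C *
      (B *m adjmx B) (enum_val i) (enum_val j)).
    rewrite !mxE big_distrr; apply: eq_bigr => y _ /=.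
    by rewrite !mxE rmorphM [X in _ * (X * _)]conjc_real mulrACA.
  rewrite Bij (inj_eq enum_val_inj) !mxE; case: eqP => [<-|_]; last by rewrite mulr0.
  rewrite mulr1n -!rmorphM -invfM -expr2 sqr_sqrtr ?f0 //=.
  by rewrite mulVf.
apply/matrixP => x y; rewrite mul_tr_diag_mx {1}psiE mxE.
rewrite (bigID K) /= [X in _ + X]big1 => [|k]; last first.
  rewrite negbK psumr_eq0 => [/allP fk0|? _]; last exact: sqn_ge0.
  have /eqP -> : B k y == 0 by rewrite -sqn_eq0; apply: fk0; rewrite mem_index_enum.
  by rewrite mulr0.
rewrite addr0 (big_enum_val (A := K)); apply: eq_bigr => i _.
rewrite adjmxE !mxE sE [RHS]mulrCA; congr (_ * _).
rewrite mulrA -rmorphM divff ?mul1r //.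
by rewrite sqrtr_eq0 -ltNge lt_def fK f0.
Qed.

(** The product [*t] numbers the pair (i, j) in the same way, with the second index running
    fastest. *)
Lemma nth_tens (s t : seq R) i j : (i < size s)%N -> (j < size t)%N ->
  (tens s t)`_(i * size t + j) = s`_i * t`_j.
Proof.
elim: s i => // x s IHs [|i] /= si tj; rewrite /tens allpairs_cons nth_cat size_map.
  by rewrite mul0n add0n tj (nth_map 0).
by rewrite mulSn -addnA ltnNge leq_addr /= addKn IHs.
Qed.

Lemma svd_tens a b c d (psi : 'M[C]_(a, b)) (phi : 'M[C]_(c, d)) s t :
  svd psi s -> svd phi t -> svd (psi *t phi) (tens s t).
Proof.
case=> s0 [U [V [uU uV ->]]] [t0 [U' [V' [uU' uV' ->]]]].
apply: (svdI (U := U *t U') (V := V *t V')).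
- by rewrite size_allpairs.
- exact: tens_ge0.
- exact: tens_unitary.
- exact: tens_unitary.
rewrite trmx_tens -!tensmx_mul; congr (_ *m _ *m _).
apply/matrixP => i j.
case: (mxtens_indexP i) => i1 i2; case: (mxtens_indexP j) => j1 j2.
rewrite tensmxE !mxE (can_eq (@mxtens_indexK _ _)) xpair_eqE.
case: eqP => _; case: eqP => _; rewrite ?(mulr0n, mul0r, mulr0) //= nth_tens //.
rewrite sqrtrM; last by apply: (allP s0); apply: mem_nth.
by rewrite !mulr1n rmorphM.
Qed.

Lemma svd_ntens a b (psi : 'M[C]_(a, b)) s n : (0 < n)%N ->
  svd psi s -> svd (psi ^t n) (spow s n).
Proof.
case: n => // n _ hs; elim: n => [|n IHn]; first by rewrite ntensmx1 /= tens1.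
by rewrite ntensmxSS; apply: svd_tens.
Qed.

(** Two decompositions of one state have the same hockey sums, so [locc] can be tested on any chosen
    lists, sorted or not. *)
Lemma loccE a b c d (psi : 'M[C]_(a, b)) (phi : 'M[C]_(c, d)) s t :
  svd psi s -> svd phi t -> locc psi phi <-> hockey_le s t.
Proof.
move=> hs ht; split.
  case=> s' [t' [/schmidt_coefsE[ss' hs'] /schmidt_coefsE[_ ht'] st']].
  apply: hockey_le_trans (svd_hockey_le hs hs') _.
  apply: hockey_le_trans (svd_hockey_le ht' ht).
  exact: majorized_hockey.
have srt (u : seq R) : sorted >=%R (sort >=%R u).
  by apply: sort_sorted => x y; apply: le_total.
move=> st; exists (sort >=%R s), (sort >=%R t); split.
- by apply/schmidt_coefsE; split=> //; apply: svd_sort.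
- by apply/schmidt_coefsE; split=> //; apply: svd_sort.
apply: hockey_majorized => //; first by rewrite all_sort (svd_ge0 ht).
apply: hockey_le_trans (svd_hockey_le (svd_sort hs) hs) _.
exact: hockey_le_trans st (svd_hockey_le ht (svd_sort ht)).
Qed.

End Schmidt.

(** A nonempty bounded set of naturals has a maximum, so [xget] does not fall back on its default
    0. *)
Lemma max_or0_ge (A : set nat) N n : ubound A N -> A n -> (n <= max_or0 A)%N.
Proof.
move=> AN An.
have exA : exists m, `[< A m >] by exists n; apply/asboolP.
have ubA m : `[< A m >] -> (m <= N)%N by move=> /asboolP /AN.
case: (ex_maxnP exA ubA) => m /asboolP Am mub.
have [_ ub] : (A `&` ubound A)%classic (max_or0 A).
  by apply: xgetPex; exists m; split=> // k /asboolP /mub.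
exact: ub.
Qed.

Lemma max_or0_mem (A : set nat) : (0 < max_or0 A)%N -> A (max_or0 A).
Proof.
rewrite /max_or0; case: xgetP => [n _ [An _] //|_]; by rewrite ltnn.
Qed.

(** * Rates *)

Section Rates.
Variables (R : realType) (a b c d : nat).
Variables (psi1 : 'M[R[i]]_(a, b)) (psi2 : 'M[R[i]]_(c, d)) (s t : seq R).
Hypotheses (hs : svd psi1 s) (ht : svd psi2 t).
Hypotheses (s1 : \sum_(x <- s) x = 1) (t1 : \sum_(x <- t) x = 1).
Hypotheses (s2 : (2 <= rk s)%N) (t2 : (2 <= rk t)%N).

Definition copies m : set nat :=
  [set n | (1 <= n)%N /\ locc (psi1 ^t m) (psi2 ^t n)]%classic.

Definition catalytic_copies m : set nat :=
  [set n | (1 <= n)%N /\ exists (p q : nat) (phi : 'M[R[i]]_(p, q)),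
    is_state phi /\ locc (psi1 ^t m *t phi) (psi2 ^t n *t phi)]%classic.

Lemma catalytic_copiesP m n : (0 < m)%N -> catalytic_copies m n <->
  (0 < n)%N /\ exists r p q (phi : 'M[R[i]]_(p, q)), [/\ is_state phi, svd phi r &
    hockey_le (tens (spow s m) r) (tens (spow t n) r)].
Proof.
move=> m0; split.
  case=> n0 [p [q [phi [phi1 h]]]]; split=> //; have [r hr] := svd_exists phi.
  exists r, p, q, phi; split=> //.
  exact/(loccE (svd_tens (svd_ntens m0 hs) hr) (svd_tens (svd_ntens n0 ht) hr)).
case=> n0 [r [p [q [phi [phi1 hr h]]]]]; split=> //; exists p, q, phi; split=> //.
exact/(loccE (svd_tens (svd_ntens m0 hs) hr) (svd_tens (svd_ntens n0 ht) hr)).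
Qed.

Lemma copiesP m n : (0 < m)%N ->
  copies m n <-> (0 < n)%N /\ hockey_le (spow s m) (spow t n).
Proof.
by move=> m0; split=> -[n0 h]; split=> //;
  apply/(loccE (svd_ntens m0 hs) (svd_ntens n0 ht)).
Qed.

(** The rank is multiplicative and does not increase, and the positive rank of the catalyst cancels.
    This leaves n < 2 ^ n <= rk t ^ n <= rk s ^ m. *)
Lemma catalytic_copies_ub m : (0 < m)%N ->
  ubound (catalytic_copies m) (rk s ^ m)%N.
Proof.
move=> m0 n /(catalytic_copiesP _ m0)[n0 [r [p [q [phi [phi1 hr h]]]]]].
have r0 := svd_ge0 hr; have r1 := svd_sum phi1 hr.
have [s0 t0] := (svd_ge0 hs, svd_ge0 ht).
have := hockey_le_rk (tens_ge0 (spow_ge0 m s0) r0) (tens_ge0 (spow_ge0 n t0) r0) _ h.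
rewrite !sum_tens !sum_spow // => /(_ erefl); rewrite !rk_tens !rk_spow.
have rr0 : (0 < rk r)%N.
  rewrite /rk -has_count; apply: contraT => /hasPn rn.
  have := r1; rewrite big1_seq => [/eqP|x /= /rn /negPn /eqP //].
  by rewrite eq_sym oner_eq0.
rewrite leq_pmul2r // => h2; apply: leq_trans h2.
apply: leq_trans (ltnW (ltn_expl n (isT : (1 < 2)%N))) _.
by rewrite leq_exp2r.
Qed.

Lemma copies_sub m : is_state psi1 -> (0 < m)%N ->
  (copies m `<=` catalytic_copies m)%classic.
Proof.
move=> psi1_1 m0 n /(copiesP _ m0)[n0 h]; apply/catalytic_copiesP => //.
(* The state psi1 itself serves as an idle catalyst. *)
split=> //; exists s, a, b, psi1; split=> //.
exact: hockey_le_tensr (svd_ge0 hs) h.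
Qed.

Lemma copies_catalysis m n : (0 < m)%N -> catalytic_copies m n ->
  exists p, forall k, (0 < k)%N -> copies (k * m + p) (k * n).
Proof.
move=> m0 /(catalytic_copiesP _ m0)[n0 [r [u [v [phi [phi1 hr h]]]]]].
have [p hp] := catalysis_removal (svd_ge0 hs) s1 s2 (svd_ge0 ht) (svd_ge0 hr)
  (svd_sum phi1 hr) h.
exists p => k k0; apply/copiesP; first by rewrite addn_gt0 muln_gt0 k0 m0.
by rewrite muln_gt0 k0 n0.
Qed.

End Rates.

Theorem theorem3 (R : realType) (a b c d : nat)
    (psi1 : 'M[R[i]]_(a, b)) (psi2 : 'M[R[i]]_(c, d))
    (state1 : is_state psi1) (state2 : is_state psi2)
    (entangled1 : entangled psi1) (entangled2 : entangled psi2) :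
  catalytic_exchange_rate psi1 psi2 = exchange_rate psi1 psi2.
Proof.
case: entangled1 => s /schmidt_coefsE[_ hs] s2.
case: entangled2 => t /schmidt_coefsE[_ ht] t2.
have [s1 t1] := (svd_sum state1 hs, svd_sum state2 ht).
have ubc := catalytic_copies_ub hs ht s1 t1 t2.
have sub := copies_sub hs ht state1.
have ub m : (0 < m)%N -> ubound (copies psi1 psi2 m) (rk s ^ m)%N.
  by move=> m0 n /(sub _ m0); apply: ubc.
apply/eqP; rewrite eq_le; apply/andP; split; apply: ge_ereal_sup => _ [m m0 <-].
  set n := catalytic_max_copies psi1 psi2 m.
  set D := exchange_rate psi1 psi2.
  have D_ge k : (0 < k)%N -> (((max_copies psi1 psi2 k)%:R / k%:R)%:E <= D)%E.
    by move=> k0; apply: ereal_sup_ubound; exists k.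
  have [n0|n_gt0] := posnP n.
    (* If no catalytic conversion exists, it is enough that D >= 0, seen from the term m = 1. *)
    rewrite n0 mul0r; apply: le_trans (D_ge 1%N isT).
    by rewrite lee_fin divr_ge0.
  have [p hp] := copies_catalysis hs ht s1 s2 m0 (max_or0_mem n_gt0).
  rewrite leNgt; apply/negP => Dn.
  have {}D_ge k : (0 < k)%N -> (((k * n)%:R / (k * m + p)%:R)%:E <= D)%E.
    move=> k0; have km0 : (0 < k * m + p)%N by rewrite addn_gt0 muln_gt0 k0 m0.
    apply: le_trans (D_ge _ km0); rewrite lee_fin ler_pM2r ?invr_gt0 ?ltr0n //.
    by rewrite ler_nat; apply: max_or0_ge (ub _ km0) (hp _ k0).
  (* The value +oo contradicts D < n/m, and -oo contradicts the lower bound at k = 1. *)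
  case: D Dn D_ge => [y| |] //; last by move=> _ /(_ 1%N isT).
  rewrite lte_fin => yn D_ge.
  have mR : 0 < m%:R :> R by rewrite ltr0n.
  have gap : 0 < n%:R - y * m%:R by rewrite subr_gt0 -ltr_pdivlMr.
  (* The bound k * n <= y * (k * m + p) says k * (n - y * m) <= y * p; it fails once k exceeds |y *
     p| / (n - y * m). *)
  have := @archi_boundP _ (`|y * p%:R| / (n%:R - y * m%:R)).
  have quot0 : 0 <= `|y * p%:R| / (n%:R - y * m%:R) by rewrite divr_ge0 // ltW.
  move/(_ quot0); set k := Num.bound _ => hk.
  have k0 : (0 < k)%N.
    by rewrite -(ltr_nat R); apply: le_lt_trans hk.
  have := D_ge k k0; rewrite lee_fin ler_pdivrMr; last first.
    by rewrite ltr0n addn_gt0 muln_gt0 k0 m0.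
  move: hk; rewrite ltr_pdivrMr // natrD !natrM.
  have := ler_norm (y * p%:R); nra.
(* Conversely, the two suprema are compared term by term at the same m. *)
apply: le_ereal_sup_tmp.
exists ((catalytic_max_copies psi1 psi2 m)%:R / m%:R)%:E; first by exists m.
rewrite lee_fin ler_pM2r ?invr_gt0 ?ltr0n // ler_nat.
have [->//|f0] := posnP (max_copies psi1 psi2 m).
exact: max_or0_ge (ubc _ m0) (sub _ m0 _ (max_or0_mem f0)).
Qed.
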